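(* Let $S=\mathbb Z[X_i]_{i\in I}$ be a (commutative) polynomial ring, $\mathfrak a=\langle P_\alpha\rangle_{\alpha\in A}$ the ideal of $S$ generated by a family of polynomials $P_\alpha\in S$, and $R=S/\mathfrak a$. Let $I_*=I\sqcup\{*\}$, put $X_*:=2\in S$, choose a total ordering on $I_*$, and for $i\in I_*$ let $x_i$ be the class of $X_i$ in $R$ and $\pi_i=x_i^2-x_i\in R$ (so $\pi_*=\bar2$). Then the ideal $I_2$ of $R$ generated by all $r^2-r$, $r\in R$, is, as an $R$-module, presented by the generators $\pi_i$, $i\in I_*$, subject to the relations $$(x_i^2-x_i)\,\pi_j=(x_j^2-x_j)\,\pi_i\qquad (i,j)\in I_*^2,\ i<j,$$ $$\overline{D_S(P_\alpha)}=0\qquad \alpha\in A,$$ where $\overline{D_S(P_\alpha)}$ is the formal $R$-linear combination of the generators $\pi_i$ described in the context.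
   Context: For $P\in S$ put $D_S(P)=P^2-P$. It lies in the ideal $I_2(S)$ of $S$ generated by all $Q^2-Q$, $Q\in S$, and it can be written as a finite $S$-linear combination $D_S(P)=\sum_{i\in I_*}c_i\,(X_i^2-X_i)$ with $c_i\in S$ (note $X_*^2-X_*=2$). The expression $\overline{D_S(P)}$ is obtained by replacing each $X_i^2-X_i$ by the generator $\pi_i$ and each $c_i$ by its class $\bar c_i\in R$: $\overline{D_S(P)}=\sum_{i\in I_*}\bar c_i\,\pi_i$, viewed as an element of the free $R$-module on the symbols $\pi_i$ (modulo the first family of relations). *)

(* Defs.v *)
From HB Require Import structures.
From mathcomp Require Import all_boot all_algebra finmap boolp classical_sets.
From mathcomp Require Import generic_quotient ring_quotient.
From mathcomp.multinomials Require Import monalg.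

Set Implicit Arguments.
Unset Strict Implicit.
Unset Printing Implicit Defensive.

Import GRing.Theory.

Local Open Scope classical_set_scope.
Local Open Scope ring_scope.
Local Open Scope quotient_scope.

(* [gen_submod X] is the submodule of M generated by X.                       *)
Definition gen_submod (R : pzRingType) (M : lmodType R) (X : set M) : set M :=
  smallest (fun N : set M => GRing.submod_closed (mem N)) X.

Definition gen_ideal (R : comPzRingType) (X : set R) : set R :=
  @gen_submod R R^o X.

Lemma gen_submod_closed (R : pzRingType) (M : lmodType R) (X : set M) :
  GRing.submod_closed (mem (gen_submod X)).
Proof.
split=> [|a u v /set_mem Xu /set_mem Xv].
  by apply/mem_set => N [[/set_mem N0 _] _].
apply/mem_set => N [cN sXN]; have [_ linN] := cN.
by apply/set_mem/linN; apply/mem_set; [exact: Xu|exact: Xv].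
Qed.

(* The quotient R / <X>. The library's {ideal_quot _} only covers proper      *)
(* ideals; here <X> may be the whole ring, in which case the quotient is 0.   *)
Section IdealQuotient.
Variables (R : comPzRingType) (X : set R).

Definition ideal_pred : R -> bool := fun x => x \in gen_ideal X.

Let ideal_pred_zmod : zmod_closed ideal_pred.
Proof. exact: GRing.submod_closedB (gen_submod_closed (M := R^o) X). Qed.

HB.instance Definition _ := GRing.isZmodClosed.Build R ideal_pred ideal_pred_zmod.

Definition zquot := Quotient.quot (GRing.ZmodClosed.clone R ideal_pred _).

Definition ideal_quotient : Type := zquot.

HB.instance Definition _ := GRing.Zmodule.on ideal_quotient.

Definition quot_class (x : R) : ideal_quotient := \pi_zquot x.

Definition quot_one : ideal_quotient := quot_class 1.
Definition quot_mul (x y : ideal_quotient) : ideal_quotient :=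
  quot_class (repr (x : zquot) *
              repr (y : zquot)).

Lemma quot_class_eq (x y : R) :
  (quot_class x == quot_class y) = (x - y \in gen_ideal X).
Proof. by rewrite /quot_class -Quotient.idealrBE. Qed.

Lemma quot_class_surj (q : ideal_quotient) : exists x, q = quot_class x.
Proof.
by exists (repr (q : zquot)); rewrite /quot_class reprK.
Qed.

Lemma quot_class_zmod : zmod_morphism quot_class.
Proof. by move=> x y; rewrite /quot_class raddfB. Qed.

Let gen_idealM (a u : R) : u \in gen_ideal X -> a * u \in gen_ideal X.
Proof.
have [X0 lin] := gen_submod_closed (M := R^o) X.
by move=> Xu; rewrite -[a * u]addr0; exact: lin.
Qed.

Lemma quot_classM : {morph quot_class : x y / x * y >-> quot_mul x y}.
Proof.
move=> x y; apply/eqP; rewrite quot_class_eq.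
set x' := repr _; set y' := repr _.
have Ex : x - x' \in gen_ideal X by rewrite -quot_class_eq /quot_class reprK.
have Ey : y - y' \in gen_ideal X by rewrite -quot_class_eq /quot_class reprK.
have -> : x * y - x' * y' = y * (x - x') + x' * (y - y').
  by rewrite !mulrBr [y * x]mulrC [y * x']mulrC addrA subrK.
have [_ lin] := gen_submod_closed (M := R^o) X.
by apply: lin => //; exact: gen_idealM.
Qed.

Let quot_mulA : associative quot_mul.
Proof.
move=> x y z; have [[a ->] [b ->] [c ->]] :=
  And3 (quot_class_surj x) (quot_class_surj y) (quot_class_surj z).
by rewrite -!quot_classM mulrA.
Qed.

Let quot_mulC : commutative quot_mul.
Proof. by move=> x y; rewrite /quot_mul mulrC. Qed.

Let quot_mul1 : left_id quot_one quot_mul.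
Proof.
by move=> x; have [a ->] := quot_class_surj x; rewrite -quot_classM mul1r.
Qed.

Let quot_mulD : left_distributive quot_mul +%R.
Proof.
move=> x y z; have [[a ->] [b ->] [c ->]] :=
  And3 (quot_class_surj x) (quot_class_surj y) (quot_class_surj z).
have addE u v : quot_class u + quot_class v = quot_class (u + v).
  by rewrite /quot_class raddfD.
by rewrite addE -!quot_classM addE mulrDl.
Qed.

HB.instance Definition _ := GRing.Zmodule_isComPzRing.Build ideal_quotient
  quot_mulA quot_mulC quot_mul1 quot_mulD.

HB.instance Definition _ := GRing.isZmodMorphism.Build R ideal_quotient
  quot_class quot_class_zmod.
HB.instance Definition _ := GRing.isMonoidMorphism.Build R ideal_quotient
  quot_class (conj erefl quot_classM).

End IdealQuotient.

(* The free R-module on K: finitely supported functions K -> R. The library's *)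
(* module structure on {malg R[K]} asks for 1 != 0 in R, hence the alias.     *)
Definition freemod (R : pzRingType) (K : choiceType) : Type := {malg R[K]}.

HB.instance Definition _ (R : pzRingType) (K : choiceType) :=
  GRing.Zmodule.on (freemod R K).

Section FreeModule.
Variables (R : pzRingType) (K : choiceType).
Implicit Types (a b : R) (f g : freemod R K).

Definition fm_scale a f : freemod R K := [malg k in msupp f => a * f@_k].

Lemma fm_scaleE a f k : (fm_scale a f)@_k = a * f@_k.
Proof. by rewrite mcoeffE; case: msuppP; rewrite ?mulr0. Qed.

Let fm_scaleA a b f : fm_scale a (fm_scale b f) = fm_scale (a * b) f.
Proof. by apply/malgP => k; rewrite !fm_scaleE mulrA. Qed.

Let fm_scale1 : left_id 1 fm_scale.
Proof. by move=> f; apply/malgP => k; rewrite fm_scaleE mul1r. Qed.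

Let fm_scaleDr : right_distributive fm_scale +%R.
Proof.
by move=> a f g; apply/malgP => k; rewrite mcoeffD !fm_scaleE mcoeffD mulrDr.
Qed.

Let fm_scaleDl f : {morph fm_scale^~ f : a b / a + b}.
Proof. by move=> a b; apply/malgP => k; rewrite mcoeffD !fm_scaleE mulrDl. Qed.

HB.instance Definition _ := GRing.Zmodule_isLmodule.Build R (freemod R K)
  fm_scaleA fm_scale1 fm_scaleDr fm_scaleDl.

Definition fm_gen (k : K) : freemod R K := << 1 *g k >>.

(* The R-linear map freemod R K -> M sending the basis vector fm_gen k to g k *)
Definition lincomb (M : lmodType R) (g : K -> M) (f : freemod R K) : M :=
  \sum_(k <- msupp f) f@_k *: g k.

(* The submodule N of M is presented by the generators g k and the relations  *)
(* r = 0 for r in rel: the map lincomb g has image N, and its kernel is the   *)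
(* submodule generated by rel.                                                *)
Definition presented_by (M : lmodType R) (N : set M) (g : K -> M)
    (rel : set (freemod R K)) : Prop :=
  range (lincomb g) = N /\ [set f | lincomb g f = 0] = gen_submod rel.

End FreeModule.

Definition fm_map (R R' : pzRingType) (K : choiceType) (phi : R -> R')
    (f : freemod R K) : freemod R' K := [malg k in msupp f => phi f@_k].

(* Z[X_i]_{i in I}: the monoid algebra of the free commutative monoid on I.   *)
Definition polyZ (I : choiceType) : Type := {malg int[{cmonom I}]}.

HB.instance Definition _ (I : choiceType) := GRing.ComNzRing.on (polyZ I).

(* I_* is option I, with None for the extra index *.                          *)
Definition polyZ_X (I : choiceType) (i : option I) : polyZ I :=
  if i is Some j then << ucm j >> else 2.

Definition DS (I : choiceType) (P : polyZ I) : polyZ I := P ^+ 2 - P.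

(* c is the family of coefficients of an expression of D_S(P) as a finite     *)
(* S-linear combination of the X_i^2 - X_i, i in I_*.                         *)
Definition DS_decomp (I : choiceType) (P : polyZ I)
    (c : freemod (polyZ I) (option I)) : Prop :=
  DS P = \sum_(i <- msupp c) c@_i * (polyZ_X i ^+ 2 - polyZ_X i).

Definition I2 (R : comPzRingType) : set R :=
  gen_ideal (range (fun r : R => r ^+ 2 - r)).

Definition total_ordering (T : eqType) (le : rel T) : Prop :=
  [/\ reflexive le, antisymmetric le, transitive le & total le].

Section Presentation.
Variables (I : choiceType) (A : Type) (P : A -> polyZ I).

Definition quotR : comPzRingType := ideal_quotient (range P).

Definition quot_x (i : option I) : quotR := quot_class (range P) (polyZ_X i).

Definition quot_pi (i : option I) : quotR := quot_x i ^+ 2 - quot_x i.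

Definition koszul_rel (le : rel (option I)) : set (freemod quotR (option I)) :=
  [set r | exists i j, [/\ i != j, le i j &
     r = (quot_x i ^+ 2 - quot_x i) *: fm_gen quotR j
         - (quot_x j ^+ 2 - quot_x j) *: fm_gen quotR i]].

(* The formal combination \overline{D_S(P a)} determined by the chosen        *)
(* coefficients c a.                                                          *)
Definition DS_bar (c : A -> freemod (polyZ I) (option I)) (a : A) :
    freemod quotR (option I) := fm_map (quot_class (range P)) (c a).

End Presentation.

Arguments I2 R : clear implicits.
Arguments koszul_rel {I A} P le.
Arguments DS_bar {I A} P c a.

(* Main.v *)
Require Import Defs.
From HB Require Import structures.
From mathcomp Require Import all_boot all_algebra finmap boolp classical_sets.
From mathcomp.multinomials Require Import monalg.
From mathcomp Require Import ring.

Set Implicit Arguments.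
Unset Strict Implicit.
Unset Printing Implicit Defensive.

Import GRing.Theory.

Local Open Scope classical_set_scope.
Local Open Scope ring_scope.

(** Write [S] for the polynomial ring, [a] for the ideal generated by the
    [P_alpha], [R = S/a], [D(Q) = Q^2 - Q] and [e_i = D(X_i)], so that
    [e_* = 2]. From

      [D(u - v) = D(u) + D(v) + 2 (v - u v)],   [D(u v) = u^2 D(v) + v D(u)]

    the polynomials [Q] for which [D(Q)] is an [S]-combination of the [e_i] form
    a subring containing all [X_i], hence are all of [S]
    ([square_sub_lincomb]). So the [e_i] generate [I_2(S)], and their images
    [pi_i] generate [I_2(R)].

    For the relations there are two independent points.

    - Over [S] itself the only relations between the [e_i] are the Koszul
      relations [e_k e_l = e_l e_k] ([koszul_exact]). Dividing by the monic
      quadratic [e_i] in the variable [X_i], every coefficient other than the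
      one of [e_i] can be made of degree at most 1 in [X_i] by subtracting
      Koszul relations; the relation then equates a multiple of [e_i] with a
      polynomial of [X_i]-degree at most 1, so that both vanish, and [e_i] is
      eliminated. In the end only a relation [2 s = 0] remains, where [s = 0].

    - The kernel of [I_2(S) -> I_2(R)] is [a] intersected with [I_2(S)], and it
      equals [a I_2(S)] plus the ideal of the [D(P_alpha)]
      ([liftable_inter]). Indeed [Q = Q^2 - D(Q)], where [Q^2] lies in
      [a I_2(S)] as soon as [Q] is in the intersection. Modulo [a I_2(S)], the
      map [Q |-> D(Q)] is additive on [a] and satisfies
      [D(t Q) = t^2 D(Q)], so [D(Q)] is a combination of the [D(P_alpha)].

    Given a relation between the [pi_i], lift its coefficients to [S]. The
    resulting combination of the [e_i] lies in the intersection, so by the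
    second point the lift can be corrected, by elements reducing to the asserted
    relations, into a relation between the [e_i], to which the first point
    applies ([ker_lincomb]). *)

(** * Generated submodules and free modules *)

Section GeneratedSubmodule.
Context {R : pzRingType} {M : lmodType R} (X : set M).

Lemma gen_submod_ind (T : M -> Prop) :
  T 0 -> (forall a u v, T u -> T v -> T (a *: u + v)) ->
  (forall x, X x -> T x) -> forall x, gen_submod X x -> T x.
Proof.
move=> T0 Tlin TX; apply: (@smallest_sub _ _ _ [set x | T x]) => //.
split=> [|a u v /set_mem Tu /set_mem Tv]; first exact/mem_set.
exact/mem_set/Tlin.
Qed.

Lemma gen_submod_gen x : X x -> gen_submod X x.
Proof. exact: sub_gen_smallest. Qed.

Lemma gen_submod0 : gen_submod X 0.
Proof. by have [/set_mem] := gen_submod_closed X. Qed.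

Lemma gen_submodP a u v :
  gen_submod X u -> gen_submod X v -> gen_submod X (a *: u + v).
Proof.
have [_ lin] := gen_submod_closed X => Xu Xv.
by apply/set_mem/lin; apply/mem_set.
Qed.

Lemma gen_submodD u v :
  gen_submod X u -> gen_submod X v -> gen_submod X (u + v).
Proof. by rewrite -{2}[u]scale1r; exact: gen_submodP. Qed.

Lemma gen_submodZ a u : gen_submod X u -> gen_submod X (a *: u).
Proof. by rewrite -[a *: u]addr0 => Xu; exact: gen_submodP Xu gen_submod0. Qed.

End GeneratedSubmodule.

(** The effect on a combination of [x] and [y] of replacing the coefficient
    [q a + r] of [x] by the remainder [r]: the change is a multiple of the syzygy
    between [x] and [y]. *)
Lemma scaler_division (R : pzRingType) (M : lmodType R)
    (q a b r : R) (x y : M) :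
  (q * a + r) *: x - (r *: x + (q * b) *: y) = q *: (a *: x - b *: y).
Proof. by rewrite scalerDl opprD addrA addrK scalerBr !scalerA. Qed.

Section FreeModule.
Context {R : pzRingType} {K : choiceType}.
Implicit Types (f : freemod R K) (k : K).

Lemma fm_coeffZ a f k : (a *: f)@_k = a * f@_k.
Proof. exact: fm_scaleE. Qed.

Lemma fm_coeffD f g k : (f + g)@_k = f@_k + g@_k.
Proof. exact: mcoeffD. Qed.

Lemma fm_coeffZ_gen a k l : (a *: fm_gen R k)@_l = a *+ (k == l).
Proof. by rewrite fm_coeffZ mcoeffU mulrnAr mulr1. Qed.

Lemma fm_coeff_gen2 a b k k' l :
  (a *: fm_gen R k + b *: fm_gen R k')@_l = a *+ (k == l) + b *+ (k' == l).
Proof. by rewrite fm_coeffD; congr (_ + _); exact: fm_coeffZ_gen. Qed.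

Lemma fm_expand f : f = \sum_(k <- msupp f) f@_k *: fm_gen R k.
Proof.
rewrite {1}(monalgE f : f = _).
apply: eq_bigr => k _; apply/malgP => l.
by rewrite fm_coeffZ_gen mcoeffU.
Qed.

Context {M : lmodType R}.
Implicit Types g : K -> M.

Lemma lincombEw g f (d : {fset K}) : (msupp f `<=` d)%fset ->
  lincomb g f = \sum_(k <- d) f@_k *: g k.
Proof.
move=> sfd; apply: big_fset_incl => // k _ /mcoeff_outdom ->.
by rewrite scale0r.
Qed.

Lemma lincomb_is_linear g : linear (lincomb g).
Proof.
move=> a u v; pose d := (msupp (a *: u + v) `|` (msupp u `|` msupp v))%fset.
rewrite !(@lincombEw _ _ d) ?scaler_sumr -?big_split /=; first last.
- exact: fsubsetUl.
- by rewrite /d fsetUCA fsubsetUl.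
- by rewrite /d fsetUA fsubsetUr.
by apply: eq_bigr => k _; rewrite fm_coeffD fm_coeffZ scalerDl scalerA.
Qed.

HB.instance Definition _ g :=
  GRing.isLinear.Build R (freemod R K) M _ (lincomb g) (lincomb_is_linear g).

Lemma lincomb_gen g k : lincomb g (fm_gen R k) = g k.
Proof.
rewrite (@lincombEw _ _ [fset k]%fset) ?msuppU_le //.
by rewrite big_seq_fset1 mcoeffUU scale1r.
Qed.

End FreeModule.

(** * Change of scalars *)

Section BaseChange.
Context {S R : pzRingType} {K : choiceType} (phi : {rmorphism S -> R}).
Implicit Types (f : freemod S K) (k : K).

Lemma fm_mapE f k : (fm_map phi f)@_k = phi f@_k.
Proof. by rewrite mcoeffE; case: msuppP => //; rewrite rmorph0. Qed.

Lemma fm_mapP a u v :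
  fm_map phi (a *: u + v : freemod S K) = phi a *: fm_map phi u + fm_map phi v.
Proof.
apply/malgP => k.
rewrite fm_mapE fm_coeffD fm_coeffZ fm_coeffD fm_coeffZ !fm_mapE.
by rewrite rmorphD rmorphM.
Qed.

Lemma fm_map0 : fm_map phi (0 : freemod S K) = 0.
Proof. by apply/malgP => k; rewrite fm_mapE !mcoeff0 rmorph0. Qed.

Lemma fm_mapD u v :
  fm_map phi (u + v : freemod S K) = fm_map phi u + fm_map phi v.
Proof. by rewrite -[u]scale1r fm_mapP rmorph1 !scale1r. Qed.

Lemma fm_mapZ a u : fm_map phi (a *: u : freemod S K) = phi a *: fm_map phi u.
Proof. by rewrite -[a *: u]addr0 fm_mapP fm_map0 addr0. Qed.

Lemma fm_map_gen k : fm_map phi (fm_gen S k) = fm_gen R k.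
Proof. by apply/malgP => l; rewrite fm_mapE !mcoeffU rmorphMn rmorph1. Qed.

Lemma lincomb_map (e : K -> S) f :
  lincomb (M := R^o) (phi \o e) (fm_map phi f) = phi (lincomb (M := S^o) e f).
Proof.
rewrite (@lincombEw _ _ _ _ _ (msupp f)).
  by rewrite rmorph_sum; apply: eq_bigr => k _; rewrite fm_mapE rmorphM.
apply/fsubsetP => k; rewrite -!mcoeff_neq0 fm_mapE.
by apply: contraNneq => ->; rewrite rmorph0.
Qed.

Lemma fm_map_surj : (forall r, exists s, phi s = r) ->
  forall f : freemod R K, exists s, fm_map phi s = f.
Proof.
move=> /choice[psi psiK] f; exists [malg k in msupp f => psi f@_k].
apply/malgP => k; rewrite fm_mapE mcoeffE.
by case: msuppP; rewrite ?psiK ?rmorph0.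
Qed.

End BaseChange.

(** * Koszul syzygies and relations in a quotient ring *)

Definition koszul_syz (R : pzRingType) (K : choiceType) (e : K -> R) :
    set (freemod R K) :=
  [set r | exists k l, r = e k *: fm_gen R l - e l *: fm_gen R k].

Lemma koszul_syz_ker (R : comPzRingType) (K : choiceType) (e : K -> R) c :
  gen_submod (koszul_syz e) c -> lincomb (M := R^o) e c = 0.
Proof.
move: c; apply: gen_submod_ind => [|a u v u0 v0|_ [k [l ->]]].
- by rewrite raddf0.
- by rewrite linearP /= u0 v0 scaler0 addr0.
- rewrite raddfB /= !linearZ /= !lincomb_gen.
  rewrite -[LHS]/(e k * e l + e l * - e k : R).
  by rewrite mulrN [e k * e l]mulrC subrr.
Qed.

(** Here [phi] presents [R] as the quotient of [S] by the ideal of [X], and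
    [rel] is a set of candidate relations over [R]. *)
Section QuotientRelations.
Context {S R : comPzRingType} {K : choiceType} (phi : {rmorphism S -> R}).
Variables (X : set S) (e : K -> S) (rel : set (freemod R K)).
Hypothesis phi_surj : forall r, exists s, phi s = r.
Hypothesis phi_ker : forall s, phi s = 0 <-> gen_ideal X s.
Hypothesis e_gen : forall s, exists c, s ^+ 2 - s = lincomb (M := S^o) e c.
Hypothesis e_koszul : forall c,
  lincomb (M := S^o) e c = 0 -> gen_submod (koszul_syz e) c.
Hypothesis rel_koszul : koszul_syz (phi \o e) `<=` gen_submod rel.
Hypothesis rel_gen : forall x, X x -> exists2 c,
  x ^+ 2 - x = lincomb (M := S^o) e c & gen_submod rel (fm_map phi c).

(** For [s] in the kernel of [phi], an expression of [s] by the [e k] reduces to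
    a relation between the [phi (e k)] over [R]; the condition says that, for
    one such expression, this relation follows from [rel]. *)
Definition liftable (s : S) : Prop :=
  exists2 c, s = lincomb (M := S^o) e c & gen_submod rel (fm_map phi c).

Lemma liftableP a s t : liftable s -> liftable t -> liftable (a * s + t).
Proof.
move=> [c -> Nc] [d -> Nd]; exists (a *: c + d); first by rewrite linearP.
by rewrite fm_mapP; exact: gen_submodP.
Qed.

Lemma liftableD s t : liftable s -> liftable t -> liftable (s + t).
Proof. by rewrite -{2}[s]mul1r; exact: liftableP. Qed.

Lemma liftable0 : liftable 0.
Proof. by exists 0; rewrite ?raddf0 // fm_map0; exact: gen_submod0. Qed.

(** Coefficients in the kernel of [phi] reduce to zero. *)
Lemma liftable_ker s c : phi s = 0 -> liftable (s * lincomb (M := S^o) e c).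
Proof.
move=> s0; exists (s *: c); first by rewrite linearZ.
by rewrite fm_mapZ s0 scale0r; exact: gen_submod0.
Qed.

(** On the kernel of [phi] the map [u |-> u^2 - u] is semilinear up to liftable
    elements: the correction terms in [(a u + v)^2 - (a u + v)] are multiples of
    [a^2 - a] and of [2] by elements of the kernel. Hence it suffices to treat
    generators of the kernel. *)
Lemma liftable_boole s : phi s = 0 -> liftable (s ^+ 2 - s).
Proof.
(* 2 is the value of u^2 - u at u = -1. *)
have [c2 c2E] : exists c2, 2 = lincomb (M := S^o) e c2.
  by have [c cE] := e_gen (- 1); exists c; rewrite -cE sqrrN expr1n opprK.
suff H u : gen_ideal X u -> phi u = 0 /\ liftable (u ^+ 2 - u).
  by move=> /phi_ker /H [].
move: u; apply: (@gen_submod_ind S S^o X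
  (fun u : S => phi u = 0 /\ liftable (u ^+ 2 - u))) =>
  [|a u v [u0 Lu] [v0 Lv]|x Xx].
- by rewrite rmorph0 expr2 mul0r subr0; split=> //; exact: liftable0.
- split; first by rewrite rmorphD rmorphM u0 v0 mulr0 addr0.
  have [c cE] := e_gen a.
  have -> : ((a *: u + v : S^o) ^+ 2 - (a *: u + v) : S) =
      a ^+ 2 * (u ^+ 2 - u) +
      (u * (a ^+ 2 - a) + ((v ^+ 2 - v) + (a * u * v) * 2)).
    by rewrite -[a *: u]/(a * u : S); ring.
  apply: liftableP => //; rewrite cE c2E; apply: liftableD.
    exact: liftable_ker.
  apply: liftableD => //; apply: liftable_ker.
  by rewrite rmorphM v0 mulr0.
- by split; [apply/phi_ker; exact: gen_submod_gen|exact: (rel_gen Xx)].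
Qed.

(** Both terms of [s = - (s^2 - s) + s * s] are liftable, the second one because
    it is the product of an element of the kernel and one of [I_2(S)]. *)
Lemma liftable_inter c :
  phi (lincomb (M := S^o) e c) = 0 -> liftable (lincomb (M := S^o) e c).
Proof.
set s : S := lincomb (M := S^o) _ _ => s0.
have -> : s = (-1) * (s ^+ 2 - s) + s * s.
  by rewrite mulN1r opprB -expr2 subrK.
by apply: liftableP; [exact: liftable_boole|exact: liftable_ker].
Qed.

Lemma gen_submod_map c :
  gen_submod (koszul_syz e) c -> gen_submod rel (fm_map phi c).
Proof.
move: c; apply: gen_submod_ind => [|a u v Nu Nv|_ [k [l ->]]].
- by rewrite fm_map0; exact: gen_submod0.
- by rewrite fm_mapP; exact: gen_submodP.
- apply: rel_koszul; exists k, l.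
  by rewrite -scaleNr fm_mapP fm_mapZ !fm_map_gen rmorphN scaleNr.
Qed.

(** A lift of [f] to [S] differs by a combination reducing into [rel] from a
    relation between the [e k], which is Koszul. *)
Lemma ker_lincomb f :
  lincomb (M := R^o) (phi \o e) f = 0 -> gen_submod rel f.
Proof.
have [c <-] := fm_map_surj phi_surj f.
rewrite lincomb_map => /liftable_inter [d cd Nd].
rewrite -[c](subrK d) fm_mapD; apply: gen_submodD => //.
apply: gen_submod_map; apply: e_koszul.
by rewrite (raddfB (lincomb (M := S^o) e)) /= cd subrr.
Qed.

End QuotientRelations.
(** * Integral polynomials *)

Section Polynomials.
Context {I : choiceType}.
Implicit Types (Q : polyZ I) (m : {cmonom I}) (i : I).

Lemma cm_split m i : (0 < m i)%N -> exists m', m = mmul (ucm i) m'.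
Proof.
move=> mi; exists (divcm m (ucm i)); apply/eqP/cmP => j.
rewrite cmM divcmE ucmE subnKC //.
by case: eqVneq => // <-.
Qed.

Lemma monomM m1 m2 : (<< mmul m1 m2 >> : polyZ I) = << m1 >> * << m2 >>.
Proof. by rewrite [RHS]fgmulUU mulr1. Qed.

Lemma polyZ_ind_monom (T : polyZ I -> Prop) :
  T 0 -> (forall u v, T u -> T v -> T (u - v)) -> (forall m, T << m >>) ->
  forall Q, T Q.
Proof.
move=> T0 TB Tm Q.
have TN u : T u -> T (- u) by rewrite -[- u]add0r; exact: TB.
have TD u v : T u -> T v -> T (u + v).
  by move=> Tu Tv; rewrite -[v]opprK; apply: TB => //; exact: TN.
have Tn u n : T u -> T (u *+ n).
  by move=> Tu; elim: n => // n IH; rewrite mulrS; exact: TD.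
rewrite [Q]monalgE; apply: (big_ind T) => // m _.
rewrite -[Q@_m]intz raddfMz /=; case: (Q@_m) => n; first exact: Tn.
by apply: TN; apply: (Tn _ n.+1).
Qed.

Lemma polyZ_ind_subring (T : polyZ I -> Prop) :
  T 1 -> (forall u v, T u -> T v -> T (u - v)) ->
  (forall u v, T u -> T v -> T (u * v)) -> (forall i, T << ucm i >>) ->
  forall Q, T Q.
Proof.
move=> T1 TB TM TX; apply: polyZ_ind_monom => [||m]; [|exact: TB|].
  by rewrite -[0](subrr 1); apply: TB.
elim: {m}(mdeg m) {-2}m (erefl (mdeg m)) => [|n IHn] m.
  by move/mdeg_eq0I ->.
have [m0|[i]] := fset_0Vmem (finsupp (cmonom_val m)).
  have -> : m = onecm I.
    by apply/eqP/cmP => i; rewrite onecmE; apply/eqP; rewrite cmE_eq0 m0 inE.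
  by rewrite [mdeg _]mdeg1.
rewrite -cmE_neq0 -lt0n => /cm_split[m' ->].
rewrite mdegM mdegU add1n => -[/IHn Tm'].
rewrite monomM; exact: TM _ _ (TX i) Tm'.
Qed.

(** * Division by the quadratic of one variable *)

(** Degree at most 1 in the variable [X_i]: these are the remainders of the
    division by [X_i^2 - X_i]. *)
Definition low i Q : Prop := forall m, (1 < m i)%N -> Q@_m = 0.

Lemma low0 i : low i 0.
Proof. by move=> m _; rewrite mcoeff0. Qed.

Lemma lowB i u v : low i u -> low i v -> low i (u - v).
Proof. by move=> lu lv m mi; rewrite mcoeffB lu // lv // subrr. Qed.

Lemma lowD i u v : low i u -> low i v -> low i (u + v).
Proof. by move=> lu lv m mi; rewrite mcoeffD lu // lv // addr0. Qed.

Lemma coeff_monomM m m' Q : (<< m >> * Q)@_(mmul m m') = Q@_m'.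
Proof.
have -> : << m >> * Q = \sum_(k <- msupp Q) << 1 * Q@_k *g mmul m k >>.
  exact: fgmulUg.
rewrite [in RHS](monalgE Q) !raddf_sum /=; apply: eq_bigr => k _.
rewrite !mcoeffU mul1r; congr (_ *+ nat_of_bool _).
apply/eqP/eqP => [/eqP/cmP E|-> //]; apply/eqP/cmP => i.
by apply: (@addnI (m i)); rewrite -!cmM.
Qed.

Lemma coeff_monomM0 m m' i Q :
  (m' i < m i)%N -> (<< m >> * Q)@_m' = 0.
Proof.
move=> lt; apply: mcoeff_outdom; apply/negP => /msuppM_le[k1 [k2 []]].
rewrite msuppU1 in_fset1 => /eqP -> _ E.
by move: lt; rewrite E cmM ltnNge leq_addr.
Qed.

Lemma lowMX i j Q : i != j -> low i Q -> low i (<< ucm j >> * Q).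
Proof.
move=> ij lQ m mi; have [/cm_split[m' E]|mj] := ltnP 0 (m j); last first.
  by rewrite (@coeff_monomM0 _ _ j) // cmUU ltnS.
rewrite E coeff_monomM lQ //; move: mi.
by rewrite E cmM cmU eq_sym (negPf ij).
Qed.

Definition DX (i : option I) : polyZ I := DS (polyZ_X i).

Lemma DX_None : DX None = 2.
Proof. by rewrite /DX /DS /=; ring. Qed.

Lemma mulr_DX i Q :
  Q * DX (Some i) = << ucm i >> * (<< ucm i >> * Q) - << ucm i >> * Q.
Proof. by rewrite mulrC mulrBl expr2 -mulrA. Qed.

(** Multiplication by the other generators, which do not involve [X_i], keeps
    the remainders; this is what lets one variable be eliminated at a time. *)
Lemma lowM i (j : option I) Q : Some i != j -> low i Q -> low i (Q * DX j).
Proof.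
case: j => [j|] ij lQ; last first.
  move=> m mi.
  by rewrite DX_None mulr_natr mcoeffMn lQ // mul0rn.
rewrite mulr_DX; have ij' : i != j by [].
by apply: lowB; do ?apply: lowMX.
Qed.

(** On monomials: [X_i^2 m = m (X_i^2 - X_i) + X_i m] lowers the exponent. *)
Lemma low_div i Q : exists q r, Q = q * DX (Some i) + r /\ low i r.
Proof.
move: Q; apply: polyZ_ind_monom => [|_ _ [q [r [-> lr]]] [q' [r' [-> lr']]]|m].
- by exists 0, 0; rewrite mul0r addr0; split=> //; exact: low0.
- exists (q - q'), (r - r'); split; last exact: lowB.
  by ring.
- elim: {m}(m i).+1 {-2}m (ltnSn (m i)) => // n IHn m mn.
  have [lt1|m1] := ltnP 1 (m i); last first.
    exists 0, << m >>; rewrite mul0r add0r; split=> // m' m'i.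
    rewrite mcoeffU1; case: eqVneq => // mm'.
    by move: m1; rewrite mm' leqNgt m'i.
  have [m' E] := cm_split (ltnW lt1).
  have m'1 : (0 < m' i)%N by move: lt1; rewrite E cmM cmUU.
  have [m'' E'] := cm_split m'1.
  have [|q [r [qr lr]]] := IHn m'; first by move: mn; rewrite E cmM cmUU.
  exists (<< m'' >> + q), r; split; last exact: lr.
  have m'E : << m' >> = << ucm i >> * << m'' >> :> polyZ I.
    by rewrite E'; exact: monomM.
  have -> : << m >> = << ucm i >> * << m' >> :> polyZ I.
    by rewrite E; exact: monomM.
  have -> : r = << m' >> - q * DX (Some i) by rewrite qr addrAC subrr add0r.
  rewrite m'E /DX /DS /polyZ_X.
  by move: << ucm i >> << m'' >> => x y; ring.
Qed.

(** The vanishing of the coefficients of [Q * (X_i^2 - X_i)] at exponents of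
    [X_i] above 1 says that the coefficients of [Q] are unchanged when the
    exponent of [X_i] grows by one; but they vanish for large exponents. *)
Lemma low_mulr_eq0 i Q : low i (Q * DX (Some i)) -> Q = 0.
Proof.
move=> lQ; pose X := ucm i.
have step m : Q@_m = Q@_(mmul X m).
  have /lQ : (1 < (mmul X (mmul X m)) i)%N by rewrite !cmM !cmUU.
  rewrite mulr_DX mcoeffB => /eqP; rewrite subr_eq0 => /eqP E.
  have E1 := coeff_monomM X (mmul X m) (<< X >> * Q).
  have E2 := coeff_monomM X m Q.
  have E3 := coeff_monomM X (mmul X m) Q.
  exact: etrans (esym E2) (etrans (esym E1) (etrans E E3)).
pose B := (\max_(m <- msupp Q) (m i))%N.
apply/malgP => m; rewrite mcoeff0.
have [m' -> Bm'] : exists2 m', Q@_m = Q@_m' & (B < m' i)%N.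
  elim: B.+1 => [|n [m' -> lt]]; first by exists m.
  by exists (mmul X m'); rewrite // cmM cmUU.
apply: mcoeff_outdom; apply/negP => m'Q.
move: Bm'; rewrite ltnNge => /negP; apply.
exact: (leq_bigmax_seq (F := fun m : {cmonom I} => m i) (P := xpredT) m' m'Q).
Qed.

(** * Relations between the polynomials X_i^2 - X_i *)

Lemma square_sub_lincomb Q :
  exists c, Q ^+ 2 - Q = lincomb (M := (polyZ I)^o) DX c.
Proof.
move: Q; apply: polyZ_ind_subring.
- by exists 0; rewrite raddf0 expr1n subrr.
- move=> u v [c cE] [d dE].
  exists (c + d + (v - u * v) *: fm_gen _ None).
  rewrite !raddfD /= linearZ /= lincomb_gen -cE -dE.
  rewrite DX_None -[_ *: _]/((v - u * v) * 2 : polyZ I).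
  by ring.
- move=> u v [c cE] [d dE]; exists (u ^+ 2 *: d + v *: c).
  rewrite linearP linearZ /= -cE -dE.
  rewrite -[RHS]/(u ^+ 2 * (v ^+ 2 - v) + v * (u ^+ 2 - u) : polyZ I).
  by ring.
- by move=> i; exists (fm_gen _ (Some i)); rewrite lincomb_gen.
Qed.

Local Notation FS := (freemod (polyZ I) (option I)).
Local Notation Kos := (gen_submod (koszul_syz DX)).

(** One step of the elimination: dividing the coefficient at [k] by
    [X_i^2 - X_i], the quotient is moved to the coefficient at [i] by a Koszul
    relation. *)
Lemma koszul_reduce i (F : {fset option I}) (s : FS) :
  Some i \in F -> (msupp s `<=` F)%fset ->
  exists s' : FS, [/\ Kos (s - s'), (msupp s' `<=` F)%fset &
    forall k, k != Some i -> low i s'@_k].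
Proof.
move=> iF /fsubsetP sF; rewrite [s]fm_expand big_seq.
pose T (u : FS) := exists s' : FS, [/\ Kos (u - s'), (msupp s' `<=` F)%fset &
  forall k, k != Some i -> low i s'@_k].
apply: (big_ind T).
- exists 0; split; rewrite ?subrr ?msupp0 ?fsub0set //.
    exact: gen_submod0.
  by move=> k _; rewrite mcoeff0; exact: low0.
- move=> u v [u' [Ku su lu]] [v' [Kv sv lv]]; exists (u' + v'); split.
  + by rewrite opprD addrACA; exact: gen_submodD.
  + by apply: fsubset_trans (msuppD_le _ _) _; rewrite fsubUset su.
  + by move=> k ki; rewrite fm_coeffD; apply: lowD; [exact: lu|exact: lv].
move=> k /sF kF; have [->|ki] := eqVneq k (Some i).
  exists (s@_(Some i) *: fm_gen _ (Some i)); split.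
  - by rewrite subrr; exact: gen_submod0.
  - apply/fsubsetP => l; rewrite -mcoeff_neq0 fm_coeffZ_gen.
    by case: (eqVneq (Some i) l) => [<- //|_]; rewrite eqxx.
  - by move=> l li; rewrite fm_coeffZ_gen eq_sym (negPf li); exact: low0.
have [q [r [-> lr]]] := low_div i s@_k.
exists (r *: fm_gen _ k + (q * DX k) *: fm_gen _ (Some i)); split.
- rewrite scaler_division.
  by apply: gen_submodZ; apply: gen_submod_gen; exists (Some i), k.
- apply/fsubsetP => l.
  rewrite -mcoeff_neq0 fm_coeff_gen2.
  case: (eqVneq k l) => [<- //|_]; case: (eqVneq (Some i) l) => [<- //|_].
  by rewrite addr0 eqxx.
- move=> l li; rewrite fm_coeff_gen2.
  rewrite [Some i == l]eq_sym (negPf li) addr0.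
  by case: (k == l); [exact: lr|exact: low0].
Qed.

(** The list [l] in the induction holds the variables not yet eliminated. *)
Lemma koszul_exact (s : FS) :
  lincomb (M := (polyZ I)^o) DX s = 0 -> Kos s.
Proof.
have [l] : exists l : seq I, forall i, s@_(Some i) != 0 -> i \in l.
  exists (pmap id (msupp s)) => i si.
  by rewrite mem_pmap map_id -mcoeff_neq0.
elim: l s => [|i l IHl] s sl s0.
  (* All variables are eliminated: only a relation 2 * s_* = 0 is left. *)
  have sE : s = s@_None *: fm_gen _ None.
    apply/malgP => -[i|]; rewrite fm_coeffZ_gen //=.
    by apply/eqP; apply: contraT => /sl.
  move: s0; rewrite sE linearZ /= lincomb_gen DX_None.
  rewrite -[_ *: _]/(s@_None * 2 : polyZ I) mulr_natr => s2.
  suff -> : s@_None = 0 by rewrite scale0r; exact: gen_submod0.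
  apply/malgP => m; have /malgP/(_ m) := s2.
  by rewrite mcoeffMn !mcoeff0 => /eqP; rewrite Num.Theory.mulrn_eq0 /= => /eqP.
pose F := (msupp s `|` [fset Some i])%fset.
have [||s' [Ks' /fsubsetP s'F ls']] := @koszul_reduce i F s.
- by rewrite !inE eqxx orbT.
- exact: fsubsetUl.
rewrite -[s](subrK s'); apply: gen_submodD => //.
have s'0 : lincomb (M := (polyZ I)^o) DX s' = 0.
  rewrite -[s'](subKr s) (raddfB (lincomb (M := (polyZ I)^o) DX)) /= s0 sub0r.
  by rewrite (koszul_syz_ker Ks') oppr0.
have s'i : s'@_(Some i) = 0.
  apply: (@low_mulr_eq0 i); move: s'0.
  rewrite (@lincombEw _ _ _ _ _ F); last exact/fsubsetP.
  rewrite (big_fsetD1 (Some i)) /=; last by rewrite !inE eqxx orbT.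
  move/eqP; rewrite addr_eq0 => /eqP E.
  rewrite -[_ * _]/(s'@_(Some i) *: (DX (Some i) : (polyZ I)^o)) E -sub0r.
  apply: lowB; first exact: low0.
  rewrite big_seq; apply: (big_ind (low i)); [exact: low0|exact: lowD|].
  move=> k; rewrite in_fsetD1 => /andP[ki _].
  by apply: lowM; [rewrite eq_sym|exact: ls'].
apply: IHl => // j s'j.
have /s'F : Some j \in msupp s' by rewrite -mcoeff_neq0.
rewrite in_fsetU in_fset1 -mcoeff_neq0 => /orP[/sl|/eqP[ji]].
  rewrite inE => /orP[/eqP ji|//]; by move: s'j; rewrite ji s'i eqxx.
by move: s'j; rewrite ji s'i eqxx.
Qed.

End Polynomials.

(** * The presentation *)

(** One orientation of each Koszul relation suffices, since exchanging the two
    indices changes the sign. *)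
Lemma koszul_rel_all (I : choiceType) (A : Type) (P : A -> polyZ I)
    (le : rel (option I)) (rel : set (freemod (quotR P) (option I))) i j :
  total le ->
  gen_submod (koszul_rel P le `|` rel)
    (quot_pi P i *: fm_gen _ j - quot_pi P j *: fm_gen _ i).
Proof.
move=> le_tot; have [->|ij] := eqVneq i j.
  by rewrite subrr; exact: gen_submod0.
have /orP[lij|lji] := le_tot i j.
  by apply: gen_submod_gen; left; exists i, j.
rewrite -opprB -scaleN1r; apply: gen_submodZ; apply: gen_submod_gen.
by left; exists j, i; rewrite eq_sym.
Qed.

Theorem proposition7p2 (I : choiceType) (A : Type) (P : A -> polyZ I)
    (le : rel (option I)) (le_total : total_ordering le) :
  (forall Q : polyZ I, exists c, DS_decomp Q c) /\
  (forall c : A -> freemod (polyZ I) (option I),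
     (forall a : A, DS_decomp (P a) (c a)) ->
     presented_by (M := (quotR P)^o) (I2 (quotR P)) (quot_pi P)
       (koszul_rel P le `|` range (DS_bar P c))).
Proof.
have [_ _ _ le_tot] := le_total.
split=> [Q|c cP]; first by have [c] := square_sub_lincomb Q; exists c.
pose phi : {rmorphism polyZ I -> quotR P} := quot_class (range P).
have piE : quot_pi P = phi \o @DX I.
  by apply/funext => i; rewrite /= /DX rmorphB rmorphXn.
have phi_surj r : exists s, phi s = r.
  by have [x ->] := quot_class_surj r; exists x.
have phi_ker s : phi s = 0 <-> gen_ideal (range P) s.
  rewrite -(rmorph0 phi); split=> [/eqP|gs]; last apply/eqP.
    by rewrite quot_class_eq subr0 => /set_mem.
  by rewrite quot_class_eq subr0; apply/mem_set.
have DSbarE a : gen_submod (koszul_rel P le `|` range (DS_bar P c))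
    (fm_map phi (c a)) by apply: gen_submod_gen; right; exists a.
split; apply/seteqP; split.
- move=> _ [f _ <-].
  rewrite [f]fm_expand raddf_sum /=; apply: (big_ind (I2 (quotR P))).
  + exact: gen_submod0.
  + by move=> u v; exact: (@gen_submodD _ (quotR P)^o).
  + move=> i _; rewrite linearZ /= lincomb_gen.
    by apply: gen_submodZ; apply: gen_submod_gen; exists (quot_x P i).
- apply: gen_submod_ind => [|a u v [f _ <-] [g _ <-]|_ [r _ <-]].
  + by exists 0; rewrite ?raddf0.
  + by exists (a *: f + g); rewrite ?linearP.
  + have [s <-] := phi_surj r; have [d dE] := square_sub_lincomb s.
    exists (fm_map phi d) => //.
    by rewrite piE lincomb_map -dE rmorphB rmorphXn.
- move=> f /= f0; apply: (ker_lincomb phi_surj phi_ker square_sub_lincomb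
    (@koszul_exact I) _ _ (f := f)).
  + move=> _ [i [j ->]]; rewrite -piE.
    exact: koszul_rel_all le_tot.
  + by move=> _ [a _ <-]; exists (c a); [exact: cP|exact: DSbarE].
  + by rewrite -piE.
- apply: gen_submod_ind => /= [|a u v u0 v0|r [[i [j [_ _ ->]]]|[a _ <-]]].
  + by rewrite raddf0.
  + by rewrite linearP /= u0 v0 scaler0 addr0.
  + by apply: koszul_syz_ker; apply: gen_submod_gen; exists i, j.
  + have cPa : DS (P a) = lincomb (M := (polyZ I)^o) (@DX I) (c a) := cP a.
    rewrite piE lincomb_map -cPa.
    rewrite /DS rmorphB rmorphXn /=.
    have /phi_ker -> : gen_ideal (range P) (P a).
      by apply: gen_submod_gen; exists a.
    by rewrite expr2 mulr0 subr0.
Qed.
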